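(* Let $I$ be an infinite set. Let $\{A_i\}_{i\in I}$ be a family of complex algebras and, for each $i\in I$, let $X_i$ be a non-zero complex vector space which is a faithful $A_i$-module. Then $\bigotimes_{i\in I}X_i$ is a faithful $\bigotimes_{i\in I}A_i$-module. In particular, for every family $\{Y_i\}_{i\in I}$ of non-zero complex vector spaces, $\bigotimes_{i\in I}Y_i$ is a faithful unital $\mathbb C^{\otimes I}$-module.
   Context: A map on $\prod_{i\in I}X_i$ is multilinear if it is linear in each variable separately. The tensor product of a family $\{X_i\}_{i\in I}$ of vector spaces is a pair $(\bigotimes_{i\in I}X_i,\Theta_X)$ consisting of a vector space and a multilinear map $\Theta_X:\prod_{i\in I}X_i\to\bigotimes_{i\in I}X_i$ through which every multilinear map from $\prod_{i\in I}X_i$ to a vector space factors via a unique linear map; it exists and is unique up to canonical isomorphism. Write $\otimes_{i\in I}x_i=\Theta_X(x)$. If all $A_i$ are algebras, $\bigotimes_{i\in I}A_i$ is an algebra with $(\otimes_{i\in I}a_i)(\otimes_{i\in I}b_i)=\otimes_{i\in I}a_ib_i$. If each $X_i$ is a (left) $A_i$-module, $\bigotimes_{i\in I}X_i$ is a $\bigotimes_{i\in I}A_i$-module with $(\otimes_{i\in I}a_i)\cdot(\otimes_{i\in I}x_i)=\otimes_{i\in I}a_ix_i$. $\mathbb C^{\otimes I}$ denotes $\bigotimes_{i\in I}\mathbb C$, acting on $\bigotimes_{i\in I}Y_i$ by $(\otimes_{i\in I}\alpha_i)\cdot(\otimes_{i\in I}y_i)=\otimes_{i\in I}\alpha_iy_i$.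 A module $X$ over an algebra $A$ is faithful if the corresponding homomorphism from $A$ to the algebra of linear maps on $X$ is injective. *)

(* Defs.v *)
From HB Require Import structures.
From mathcomp Require Import all_boot all_order all_algebra generic_quotient.
From mathcomp Require Import boolp classical_sets functions.

Set Implicit Arguments.
Unset Strict Implicit.
Unset Printing Implicit Defensive.

Import GRing.Theory.
Local Open Scope ring_scope.

(* Algebras are associative but, unlike [algType], need not have a unit. *)
HB.mixin Record Lmodule_isAssocAlgebra (K : fieldType) V
    of GRing.Lmodule K V := {
  amul : V -> V -> V;
  amulA : associative amul;
  amulDl : left_distributive amul +%R;
  amulDr : right_distributive amul +%R;
  amulZl : forall k u v, amul (k *: u) v = k *: amul u v;
  amulZr : forall k u v, amul u (k *: v) = k *: amul u v
}.

#[short(type="assocAlgType")]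
HB.structure Definition AssocAlgebra (K : fieldType) :=
  { V of GRing.Lmodule K V & Lmodule_isAssocAlgebra K V }.

Section RegularAlgebra.
Variable K : fieldType.

Fact regular_mulZl (k : K) (u v : K^o) :
  (k *: u : K^o) * v = k *: (u * v : K^o).
Proof. by rewrite /GRing.scale /= mulrA. Qed.

Fact regular_mulZr (k : K) (u v : K^o) :
  u * (k *: v : K^o) = k *: (u * v : K^o).
Proof. by rewrite /GRing.scale /= mulrCA. Qed.

HB.instance Definition _ :=
  @Lmodule_isAssocAlgebra.Build K K^o *%R
    (@mulrA K) (@mulrDl K) (@mulrDr K) regular_mulZl regular_mulZr.

End RegularAlgebra.

(* Left modules over a possibly non-unital algebra [A]; unitality of the     *)
(* action is the separate predicate [unital_module].                         *)
Record amodule (K : fieldType) (A : assocAlgType K) := AModule {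
  amodule_space :> lmodType K;
  act : A -> amodule_space -> amodule_space;
  actA : forall a b x, act (amul a b) x = act a (act b x);
  actDl : forall a b x, act (a + b) x = act a x + act b x;
  actDr : forall a x y, act a (x + y) = act a x + act a y;
  actZl : forall k a x, act (k *: a) x = k *: act a x;
  actZr : forall k a x, act a (k *: x) = k *: act a x
}.

(* [act M a] is the linear operator by which [a] acts. *)
Definition faithful (K : fieldType) (A : assocAlgType K) (M : amodule A) :=
  injective (fun a : A => (act a : M -> M)).

Definition is_unit_element (K : fieldType) (A : assocAlgType K) (e : A) :=
  forall a : A, amul e a = a /\ amul a e = a.

Definition unital_module (K : fieldType) (A : assocAlgType K)
    (M : amodule A) :=
  exists e : A, is_unit_element e /\ forall x : M, act e x = x.

Definition nonzero_space (K : fieldType) (V : lmodType K) :=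
  exists x : V, x != 0.

Section ScalarModule.
Variables (K : fieldType) (Y : lmodType K).

Definition scalar_module : amodule K^o :=
  @AModule K K^o Y (fun a y => a *: y)
    (fun a b x => esym (scalerA a b x)) (fun a b x => scalerDl x a b)
    (@scalerDr K Y) (fun k a x => esym (scalerA k a x))
    (fun k a x => etrans (scalerA a k x)
       (etrans (congr1 (fun c => c *: x) (mulrC a k)) (esym (scalerA k a x)))).

End ScalarModule.

Section Tensor.
Variables (K : fieldType) (I : Type).
Implicit Types X Y Z : I -> lmodType K.

(* [dfwith x u] is the family [x] with its [i]-th entry replaced by [u]. *)
Definition multilinear X (W : lmodType K) (f : (forall i, X i) -> W) :=
  forall (i : I) (x : forall j, X j),
    linear (fun u : X i => f (dfwith (I := {classic I}) x u)).

Record tensor_product X := TensorProduct {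
  tensor_space :> lmodType K;
  tensor_map : (forall i, X i) -> tensor_space;
  tensor_multilinear : multilinear tensor_map;
  tensor_universal : forall (W : lmodType K) (f : (forall i, X i) -> W),
    multilinear f ->
    exists! g : {linear tensor_space -> W}, forall x, g (tensor_map x) = f x
}.

Lemma linear_eqfun (V W : lmodType K) (f g : {linear V -> W}) :
  f =1 g -> f = g.
Proof.
case: f g => [f [[f1] [f2]]] [g [[g1] [g2]]] /= /funext fg.
move: fg f1 f2 g1 g2 => /= -> f1 f2 g1 g2.
by rewrite (Prop_irrelevance f1 g1) (Prop_irrelevance f2 g2).
Qed.


Lemma tensor_ext X (T : tensor_product X) (W : lmodType K) (f g : T -> W) :
  linear f -> linear g ->
  (forall x, f (tensor_map T x) = g (tensor_map T x)) -> f =1 g.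
Proof.
move=> fL gL fg.
pose f' : {linear T -> W} :=
  HB.pack f (GRing.isLinear.Build K T W *:%R f fL).
pose g' : {linear T -> W} :=
  HB.pack g (GRing.isLinear.Build K T W *:%R g gL).
have fM : multilinear (fun x => f (tensor_map T x)).
  by move=> i x k u v; rewrite (tensor_multilinear T) fL.
have [h [_ huniq]] := tensor_universal T fM.
have hf : h = f' by exact: huniq.
have hg : h = g' by apply: huniq => x /=; rewrite fg.
move=> t; rewrite -[f]/(GRing.Linear.sort f') -[g]/(GRing.Linear.sort g').
by rewrite -hf hg.
Qed.

Definition tensor_lift X (T : tensor_product X) (W : lmodType K)
    (f : (forall i, X i) -> W) (fM : multilinear f) : {linear T -> W} :=
  projT1 (cid (tensor_universal T fM)).

Lemma tensor_liftE X (T : tensor_product X) (W : lmodType K)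
    (f : (forall i, X i) -> W) (fM : multilinear f) x :
  tensor_lift T fM (tensor_map T x) = f x.
Proof. by rewrite /tensor_lift; case: cid => g /= [gE _]; apply: gE. Qed.

(* Existence of tensor products: formal linear combinations of families are  *)
(* identified when no multilinear map distinguishes them.                    *)
Section Existence.
Variable X : I -> lmodType K.
Let P := forall i, X i.

Definition word : Type := {classic (seq (K * P))}.
HB.instance Definition _ := Choice.on word.

Definition word_eval (W : lmodType K) (f : P -> W) (s : word) : W :=
  \sum_(p <- (s : seq (K * P))) p.1 *: f p.2.

Definition word_equiv (s t : word) : bool :=
  `[< forall (W : lmodType K) (f : P -> W), multilinear f ->
      word_eval f s = word_eval f t >].

Fact word_equiv_refl : reflexive word_equiv.
Proof. by move=> s; apply/asboolP. Qed.

Fact word_equiv_sym : symmetric word_equiv.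
Proof. by move=> s t; apply/asboolP/asboolP => st W f /st. Qed.

Fact word_equiv_trans : transitive word_equiv.
Proof.
move=> t s u /asboolP st /asboolP tu; apply/asboolP => W f fM.
by rewrite st // tu.
Qed.

Canonical word_equiv_equiv :=
  EquivRel word_equiv word_equiv_refl word_equiv_sym word_equiv_trans.

Local Open Scope quotient_scope.

Definition free_tensor : Type := {eq_quot word_equiv}.
HB.instance Definition _ := Choice.on free_tensor.

Definition to_tensor (s : word) : free_tensor := \pi_{eq_quot word_equiv} s.
Definition tensor_word (t : free_tensor) : word :=
  repr (t : {eq_quot word_equiv}).

Lemma tensor_wordK : cancel tensor_word to_tensor.
Proof. by move=> t; rewrite /to_tensor /tensor_word reprK. Qed.

Lemma to_tensorP s t :
  to_tensor s = to_tensor t <->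
  forall (W : lmodType K) (f : P -> W), multilinear f ->
    word_eval f s = word_eval f t.
Proof.
split=> [/eqP|st]; last by apply/eqP; rewrite eqmodE; apply/asboolP.
by rewrite eqmodE => /asboolP.
Qed.

Lemma word_eval_repr s (W : lmodType K) (f : P -> W) : multilinear f ->
  word_eval f (tensor_word (to_tensor s)) = word_eval f s.
Proof. by move: W f; apply/to_tensorP; rewrite tensor_wordK. Qed.

Lemma free_tensorP t u :
  (forall (W : lmodType K) (f : P -> W), multilinear f ->
    word_eval f (tensor_word t) = word_eval f (tensor_word u)) -> t = u.
Proof. by move/to_tensorP; rewrite !tensor_wordK. Qed.

Definition word_scale (k : K) (s : word) : word :=
  [seq (k * p.1, p.2) | p <- (s : seq (K * P))].

Definition free_zero := to_tensor [::].
Definition free_add t u :=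
  to_tensor ((tensor_word t : seq (K * P)) ++ tensor_word u).
Definition free_scale k t := to_tensor (word_scale k (tensor_word t)).
Definition free_opp := free_scale (-1).

Lemma word_eval_scale (W : lmodType K) (f : P -> W) k s :
  word_eval f (word_scale k s) = k *: word_eval f s.
Proof.
rewrite /word_eval big_map scaler_sumr.
by apply: eq_bigr => p _; rewrite scalerA.
Qed.

Lemma eval_zero (W : lmodType K) (f : P -> W) : multilinear f ->
  word_eval f (tensor_word free_zero) = 0.
Proof. by move=> fM; rewrite word_eval_repr // /word_eval big_nil. Qed.

Lemma eval_add (W : lmodType K) (f : P -> W) t u : multilinear f ->
  word_eval f (tensor_word (free_add t u)) =
  word_eval f (tensor_word t) + word_eval f (tensor_word u).
Proof. by move=> fM; rewrite word_eval_repr // /word_eval big_cat. Qed.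

Lemma eval_scale (W : lmodType K) (f : P -> W) k t : multilinear f ->
  word_eval f (tensor_word (free_scale k t)) =
  k *: word_eval f (tensor_word t).
Proof. by move=> fM; rewrite word_eval_repr // word_eval_scale. Qed.

Fact free_addA : associative free_add.
Proof.
by move=> t u v; apply: free_tensorP => W f fM; rewrite !eval_add // addrA.
Qed.

Fact free_addC : commutative free_add.
Proof.
by move=> t u; apply: free_tensorP => W f fM; rewrite !eval_add // addrC.
Qed.

Fact free_add0 : left_id free_zero free_add.
Proof.
move=> t; apply: free_tensorP => W f fM.
by rewrite eval_add // eval_zero // add0r.
Qed.

Fact free_addN : left_inverse free_zero free_opp free_add.
Proof.
move=> t; apply: free_tensorP => W f fM.
by rewrite eval_add // eval_scale // eval_zero // scaleN1r addNr.
Qed.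

HB.instance Definition _ :=
  GRing.isZmodule.Build free_tensor free_addA free_addC free_add0 free_addN.

Fact free_scaleA a b t : free_scale a (free_scale b t) = free_scale (a * b) t.
Proof.
by apply: free_tensorP => W f fM; rewrite !eval_scale // scalerA.
Qed.

Fact free_scale1 : left_id 1 free_scale.
Proof.
by move=> t; apply: free_tensorP => W f fM; rewrite eval_scale // scale1r.
Qed.

Fact free_scaleDr : right_distributive free_scale +%R.
Proof.
move=> k t u; apply: free_tensorP => W f fM.
by rewrite eval_scale // !eval_add // !eval_scale // scalerDr.
Qed.

Fact free_scaleDl t : {morph free_scale^~ t : a b / a + b}.
Proof.
move=> a b; apply: free_tensorP => W f fM.
by rewrite eval_scale // eval_add // !eval_scale // scalerDl.
Qed.

HB.instance Definition _ :=
  GRing.Zmodule_isLmodule.Build K free_tensor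
    free_scaleA free_scale1 free_scaleDr free_scaleDl.

Definition free_map (x : P) : free_tensor := to_tensor [:: (1, x)].

Lemma eval_map (W : lmodType K) (f : P -> W) x : multilinear f ->
  word_eval f (tensor_word (free_map x)) = f x.
Proof.
by move=> fM; rewrite word_eval_repr // /word_eval big_seq1 scale1r.
Qed.

Fact free_map_multilinear : multilinear free_map.
Proof.
move=> i x k u v; apply: free_tensorP => W f fM.
by rewrite eval_add // eval_scale // !eval_map // fM.
Qed.

Lemma free_tensor_span t : t = word_eval free_map (tensor_word t).
Proof.
rewrite -[LHS]tensor_wordK; move: (tensor_word t) => s.
apply: free_tensorP => W f fM; rewrite word_eval_repr //.
elim: s => [|p s IHs].
  have -> : word_eval free_map [::] = 0 by rewrite /word_eval big_nil.
  by rewrite [RHS]eval_zero // /word_eval big_nil.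
have -> : word_eval free_map (p :: s) =
    free_add (free_scale p.1 (free_map p.2)) (word_eval free_map s).
  by rewrite /word_eval big_cons.
by rewrite eval_add // eval_scale // eval_map // -IHs /word_eval big_cons.
Qed.

Fact free_tensor_universal (W : lmodType K) (f : P -> W) : multilinear f ->
  exists! g : {linear free_tensor -> W}, forall x, g (free_map x) = f x.
Proof.
move=> fM; pose g t := word_eval f (tensor_word t).
have gL : linear g by move=> k t u; rewrite /g eval_add // eval_scale.
pose g' : {linear free_tensor -> W} :=
  HB.pack g (GRing.isLinear.Build K free_tensor W *:%R g gL).
exists g'; split=> [x|h hE]; first exact: eval_map.
apply: linear_eqfun => t /=; rewrite [in RHS](free_tensor_span t) /word_eval.
by rewrite linear_sum; apply: eq_bigr => p _; rewrite linearZ /= hE.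
Qed.

Definition canonical_tensor : tensor_product X :=
  TensorProduct free_map_multilinear free_tensor_universal.

End Existence.

(* The bilinear map (⊗ x_i, ⊗ y_i) |-> ⊗ b_i(x_i, y_i) induced by a family   *)
(* of bilinear maps.                                                         *)
Section Bilinear.
Variables (X Y Z : I -> lmodType K) (b : forall i, X i -> Y i -> Z i).
Hypothesis bl : forall i y, linear (fun x => b (i := i) x y).
Hypothesis br : forall i x, linear (b (i := i) x).
Variables (TX : tensor_product X) (TY : tensor_product Y)
  (TZ : tensor_product Z).

Let B (x : forall i, X i) (y : forall i, Y i) : forall i, Z i :=
  fun i => b (x i) (y i).

Let D (V : I -> lmodType K) (x : forall i, V i) i (u : V i) :=
  dfwith (I := {classic I}) x u.

Let BDl i x u y : B (D (i := i) x u) y = D (B x y) (b u (y i)).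
Proof.
apply: functional_extensionality_dep => j; rewrite /B /D.
case: (@dfwithP {classic I} X x i u j) => [|k ik].
  by rewrite dfwith_in.
by rewrite dfwith_out.
Qed.

Let BDr i x u y : B x (D (i := i) y u) = D (B x y) (b (x i) u).
Proof.
apply: functional_extensionality_dep => j; rewrite /B /D.
case: (@dfwithP {classic I} Y y i u j) => [|k ik].
  by rewrite dfwith_in.
by rewrite dfwith_out.
Qed.

Fact tensor_bilin_multilinearr x :
  multilinear (fun y => tensor_map TZ (B x y)).
Proof.
move=> i y k u v; rewrite -!/(D _ _) !BDr br.
exact: (tensor_multilinear TZ).
Qed.

Fact tensor_bilin_multilinearl :
  multilinear (fun x => tensor_lift TY (tensor_bilin_multilinearr x)
                 : TY -> TZ).
Proof.
move=> i x k u v; apply: funext => t.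
pose L (w : X i) : {linear TY -> TZ} :=
  tensor_lift TY (tensor_bilin_multilinearr (D (i := i) x w)).
rewrite -[LHS]/(L (k *: u + v) t) -[RHS]/(k *: L u t + L v t).
move: t; apply: tensor_ext => [c t t'|c t t'|y].
- exact: linearP.
- rewrite (linearP (L u)) (linearP (L v)) !scalerDr !scalerA mulrC !addrA.
  by congr (_ + _); rewrite addrAC.
- by rewrite /L !tensor_liftE !BDl bl; exact: (tensor_multilinear TZ).
Qed.

Definition tensor_bilin : TX -> TY -> TZ :=
  tensor_lift TX tensor_bilin_multilinearl.

Lemma tensor_bilinE x y :
  tensor_bilin (tensor_map TX x) (tensor_map TY y) =
  tensor_map TZ (fun i => b (x i) (y i)).
Proof. by rewrite /tensor_bilin !tensor_liftE. Qed.

Lemma tensor_bilin_linearl t : linear (tensor_bilin^~ t).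
Proof. by move=> k u v; rewrite /tensor_bilin linearP. Qed.

Lemma tensor_bilin_linearr t : linear (tensor_bilin t).
Proof.
move=> k u v; move: t; apply: tensor_ext => [c t t'|c t t'|x].
- by rewrite tensor_bilin_linearl.
- rewrite !tensor_bilin_linearl !scalerDr !scalerA mulrC !addrA.
  by congr (_ + _); rewrite addrAC.
- by rewrite /tensor_bilin !tensor_liftE linearP.
Qed.

End Bilinear.

Arguments tensor_bilin {X Y Z b} bl br TX TY TZ _ _.

Section Algebra.
Variable A : I -> assocAlgType K.
Variable TA : tensor_product (fun i => A i : lmodType K).

Let amul_linearl i (y : A i) : linear (fun x => amul x y).
Proof. by move=> k u v; rewrite amulDl amulZl. Qed.

Let amul_linearr i (x : A i) : linear (amul x).
Proof. by move=> k u v; rewrite amulDr amulZr. Qed.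

Definition tensor_mul : TA -> TA -> TA :=
  tensor_bilin amul_linearl amul_linearr TA TA TA.

Lemma tensor_mulE a b :
  tensor_mul (tensor_map TA a) (tensor_map TA b) =
  tensor_map TA (fun i => amul (a i) (b i)).
Proof. exact: tensor_bilinE. Qed.

Let tensor_mull u : linear (tensor_mul^~ u).
Proof. exact: tensor_bilin_linearl. Qed.

Let tensor_mulr u : linear (tensor_mul u).
Proof. exact: tensor_bilin_linearr. Qed.

Fact tensor_mulA : associative tensor_mul.
Proof.
move=> u v w; move: u; apply: tensor_ext => [k t t'|k t t'|a].
- by rewrite tensor_mull.
- by rewrite !tensor_mull.
move: v; apply: tensor_ext => [k t t'|k t t'|b].
- by rewrite tensor_mull tensor_mulr.
- by rewrite tensor_mulr tensor_mull.
move: w; apply: tensor_ext => [k t t'|k t t'|c].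
- by rewrite !tensor_mulr.
- by rewrite tensor_mulr.
rewrite !tensor_mulE; congr (tensor_map TA _).
by apply: functional_extensionality_dep => i; rewrite amulA.
Qed.

Fact tensor_mulDl : left_distributive tensor_mul +%R.
Proof. by move=> u v w; have := tensor_mull w 1 u v; rewrite !scale1r. Qed.

Fact tensor_mulDr : right_distributive tensor_mul +%R.
Proof. by move=> u v w; have := tensor_mulr u 1 v w; rewrite !scale1r. Qed.

Fact linear_scale (V W : lmodType K) (f : V -> W) k x :
  linear f -> f (k *: x) = k *: f x.
Proof.
move=> fL; have f0 : f 0 = 0.
  by apply: (addIr (f 0)); rewrite -{2}(scale1r 0) -[f 0 in LHS]scale1r;
     rewrite -fL scale1r !add0r.
by have := fL k x 0; rewrite f0 !addr0.
Qed.

Fact tensor_mulZl k u v : tensor_mul (k *: u) v = k *: tensor_mul u v.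
Proof. exact: (linear_scale _ _ (tensor_mull v)). Qed.

Fact tensor_mulZr k u v : tensor_mul u (k *: v) = k *: tensor_mul u v.
Proof. exact: (linear_scale _ _ (tensor_mulr u)). Qed.

Definition tensor_alg : assocAlgType K :=
  HB.pack (GRing.Lmodule.sort (tensor_space TA))
    (@Lmodule_isAssocAlgebra.Build K (tensor_space TA) tensor_mul
       tensor_mulA tensor_mulDl tensor_mulDr tensor_mulZl tensor_mulZr).

Variable X : forall i, amodule (A i).
Variable TX : tensor_product (fun i => amodule_space (X i)).

Let act_linearl i (x : X i) : linear (fun a => act a x).
Proof. by move=> k a b; rewrite actDl actZl. Qed.

Let act_linearr i (a : A i) : linear (act a : X i -> X i).
Proof. by move=> k x y; rewrite actDr actZr. Qed.

Definition tensor_act : TA -> TX -> TX :=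
  tensor_bilin act_linearl act_linearr TA TX TX.

Lemma tensor_actE a x :
  tensor_act (tensor_map TA a) (tensor_map TX x) =
  tensor_map TX (fun i => act (a i) (x i)).
Proof. exact: tensor_bilinE. Qed.

Let tensor_actl x : linear (tensor_act^~ x).
Proof. exact: tensor_bilin_linearl. Qed.

Let tensor_actr a : linear (tensor_act a).
Proof. exact: tensor_bilin_linearr. Qed.

Fact tensor_actA (u v : tensor_alg) w :
  tensor_act (amul u v) w = tensor_act u (tensor_act v w).
Proof.
rewrite -[amul u v]/(tensor_mul u v).
move: u; apply: (@tensor_ext _ TA) => [k t t'|k t t'|a].
- by rewrite tensor_mull tensor_actl.
- by rewrite tensor_actl.
move: v; apply: (@tensor_ext _ TA) => [k t t'|k t t'|b].
- by rewrite tensor_mulr tensor_actl.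
- by rewrite tensor_actl tensor_actr.
move: w; apply: tensor_ext => [k t t'|k t t'|x].
- by rewrite tensor_actr.
- by rewrite !tensor_actr.
rewrite tensor_mulE !tensor_actE; congr (tensor_map TX _).
by apply: functional_extensionality_dep => i; rewrite actA.
Qed.

Fact tensor_actDl u v w :
  tensor_act (u + v) w = tensor_act u w + tensor_act v w.
Proof. by have := tensor_actl w 1 u v; rewrite !scale1r. Qed.

Fact tensor_actDr u v w :
  tensor_act u (v + w) = tensor_act u v + tensor_act u w.
Proof. by have := tensor_actr u 1 v w; rewrite !scale1r. Qed.

Fact tensor_actZl k u v : tensor_act (k *: u) v = k *: tensor_act u v.
Proof. exact: (linear_scale _ _ (tensor_actl v)). Qed.

Fact tensor_actZr k u v : tensor_act u (k *: v) = k *: tensor_act u v.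
Proof. exact: (linear_scale _ _ (tensor_actr u)). Qed.

Definition tensor_module : amodule tensor_alg :=
  @AModule K tensor_alg TX tensor_act
    tensor_actA tensor_actDl tensor_actDr tensor_actZl tensor_actZr.

End Algebra.

End Tensor.

(* Main.v *)
(* Write an annihilating tensor as t = sum_j c_j (x)a_j. Over an infinite      *)
(* field each X_i contains an x_i outside the finitely many proper subspaces  *)
(* where two distinct elements among 0 and the a_j(i) agree, so families a_j  *)
(* that differ at infinitely many indices still do so after acting on x, and  *)
(* projecting onto a class of almost equal families isolates one class of     *)
(* the a_j. Inside a class, contracting one slot at a time against linear     *)
(* forms makes all a_j equal, by induction on the number of terms; and an     *)
(* elementary tensor with nonzero entries is nonzero.                         *)
Require Import Defs.
From mathcomp Require Import all_boot all_order all_algebra.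
From mathcomp Require Import boolp classical_sets functions cardinality fsbigop.
From mathcomp Require Import reals complex.

Set Implicit Arguments.
Unset Strict Implicit.
Unset Printing Implicit Defensive.

Import GRing.Theory Num.Theory.
Local Open Scope ring_scope.
Local Open Scope classical_set_scope.

(** Let [t = sum_j c_j ⊗a_j] act as zero. Families that differ at finitely many indices form a
    class, and the tensor product splits along classes ([tensor_class_projection]). For [x] generic
    in every slot ([exists_generic_vector]), acting on [x] does not merge classes of the [a_j]
    ([separates_act_family]), so each class of terms annihilates by itself ([kills_class]). Inside
    one class only finitely many slots distinguish the [a_j], as in a finite tensor product:
    [equalize_slot] makes the entries of one slot equal, and in the end [t = c ⊗a_j0]. If no entry
    of [a_j0] is zero, it sends some elementary tensor to one with nonzero entries, which is nonzero
    by [tensor_neq0]; so [c = 0]. [word_eq0_all] organizes this by induction on the number of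
    terms. *)

Section LinearSeparation.

(** * Linear forms on spaces of arbitrary dimension *)

Variables (K : fieldType) (V : lmodType K).

(** Zorn's lemma on subspaces avoiding [v]. Were no [x - k *: v] in the maximal [A], the larger
    space [A + K x] would still avoid [v]. *)
Lemma exists_maximal_avoiding_subspace (v : V) : v != 0 ->
  exists A : set V, [/\ A 0, (forall k x y, A x -> A y -> A (k *: x + y)),
    ~ A v & forall x, exists k, A (x - k *: v)].
Proof.
move=> v0.
pose closed (A : set V) := forall k x y, A x -> A y -> A (k *: x + y).
pose P (A : set V) := closed A /\ ~ A v.
have [F FP Ftot|A [[Acl Av] Amax]] := @Zorn_bigcup V P.
  split=> [k x y [B FB Bx] [C FC Cy]|[B FB Bv]]; last by case: (FP _ FB).
  have [BC|CB] := Ftot _ _ FB FC.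
    by exists C => //; apply: (FP _ FC).1 => //; apply: BC.
  by exists B => //; apply: (FP _ FB).1 => //; apply: CB.
(* [P] does not demand [0], so that the union of the empty chain satisfies it. A maximal [A] without
   [0] would be empty, hence smaller than [[set 0]]. *)
have A0 : A 0.
  apply: contrapT => nA0; apply: (Amax [set 0]).
    split=> [x Ax|/(_ 0 erefl)//]; exfalso; apply: nA0.
    by rewrite -(addNr x) -scaleN1r; apply: Acl.
  split=> [k x y /= -> ->|/= /eqP]; first by rewrite scaler0 addr0.
  by rewrite (negbTE v0).
exists A; split=> // x; apply: contrapT => nx.
have nAx : ~ A x by move=> Ax; apply: nx; exists 0; rewrite scale0r subr0.
pose B := [set y | exists k, A (y - k *: x)].
apply: (Amax B).
  split=> [y Ay|BA]; first by exists 0; rewrite scale0r subr0.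
  by apply/nAx/BA; exists 1; rewrite scale1r subrr.
split=> [k y z [l yl] [m zm]|[k Avk]].
  exists (k * l + m); rewrite scalerDl -scalerA opprD addrACA -scalerBr.
  exact: Acl.
have [k0|k0] := eqVneq k 0; first by apply: Av; rewrite k0 scale0r subr0 in Avk.
apply: nx; exists k^-1; have := Acl (- k^-1) _ _ Avk A0.
by rewrite addr0 scaleNr scalerBr scalerA mulVf // scale1r opprB.
Qed.

(** [f x] is the coordinate of [x] along [v] modulo a hyperplane complementary to [v]. *)
Lemma exists_dual_form (v : V) : v != 0 ->
  exists2 f : V -> K, (forall k x y, f (k *: x + y) = k * f x + f y) & f v = 1.
Proof.
move=> /exists_maximal_avoiding_subspace [A [A0 Acl Av Acpl]].
have AB x y : A x -> A y -> A (x - y).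
  by move=> Ax Ay; rewrite addrC -scaleN1r; apply: Acl.
have uniq k l x : A (x - k *: v) -> A (x - l *: v) -> k = l.
  move=> Ak Al; apply/eqP/negP => /negP kl; apply: Av.
  have := AB _ _ Al Ak; rewrite opprB addrC addrA subrK -scalerBl => Akl.
  have := Acl ((k - l)^-1) _ _ Akl A0.
  by rewrite addr0 scalerA mulVf ?scale1r // subr_eq0.
pose f x := projT1 (cid (Acpl x)).
have fA x : A (x - f x *: v) by rewrite /f; case: cid.
exists f => [k x y|]; last first.
  by apply: (uniq _ _ v); rewrite // scale1r subrr.
apply: (uniq _ _ (k *: x + y)); first exact: fA.
rewrite scalerDl -scalerA opprD addrACA -scalerBr.
by apply: Acl; apply: fA.
Qed.

End LinearSeparation.

Lemma exists_notin (T : eqType) (s : seq T) :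
  infinite_set [set: T] -> exists x, x \notin s.
Proof.
move=> Tinf; apply: contrapT => sT; apply: Tinf.
apply: (sub_finite_set _ (finite_seq s)) => x _ /=.
by apply: contrapT => /negP xs; apply: sT; exists x.
Qed.

(** * Generic vectors in a faithful module *)

Section Modules.
Variables (K : fieldType) (A : assocAlgType K) (M : amodule A).

Lemma act0l (x : M) : act 0 x = 0.
Proof. by have := actZl 0 0 x; rewrite !scale0r. Qed.

Lemma faithful_act_neq0 (a : A) : faithful M -> a != 0 ->
  exists x : M, act a x != 0.
Proof.
move=> Mf /eqP a0; apply: contrapT => nx; apply: a0; apply: Mf.
apply: funext => x; rewrite act0l; apply/eqP/negPn/negP => ax.
by apply: nx; exists x.
Qed.

Lemma actBl (a b : A) (x : M) : act (a - b) x = act a x - act b x.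
Proof. by rewrite actDl -(scaleN1r b) actZl scaleN1r. Qed.

(* Each nonzero operator excludes at most one point of the line [x + k *: w], *)
(* so an infinite field leaves room to extend a vector that is good for [s].  *)
Lemma exists_generic_vector (s : seq A) : infinite_set [set: K] ->
  faithful M -> exists x : M, forall a, a \in s -> a != 0 -> act a x != 0.
Proof.
move=> Kinf Mf; elim: s => [|a s [x xs]]; first by exists 0.
have [->|a0] := eqVneq a 0.
  by exists x => b; rewrite inE => /predU1P[->|/xs//]; rewrite eqxx.
have [w aw] := faithful_act_neq0 Mf a0.
have bad b : b \in a :: s -> b != 0 ->
    exists k, forall l, act b x + l *: act b w = 0 -> l = k.
  move=> bs b0; have [bw|bw] := eqVneq (act b w) 0.
    exists 0 => l; rewrite bw scaler0 addr0 => bx; move: bs.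
    rewrite inE => /predU1P[ba|/xs/(_ b0)]; last by rewrite bx eqxx.
    by rewrite -ba bw eqxx in aw.
  have [[k kP]|nk] := pselect (exists k, act b x + k *: act b w = 0).
    exists k => l; rewrite -kP => /addrI/eqP.
    by rewrite -subr_eq0 -scalerBl scaler_eq0 (negbTE bw) orbF subr_eq0 => /eqP.
  by exists 0 => l lP; case: nk; exists l.
have /choice[f fP] : forall b, exists k, b \in a :: s -> b != 0 ->
    forall l, act b x + l *: act b w = 0 -> l = k.
  move=> b; have [/andP[bs /(bad _ bs)[k]]|nb] :=
    boolP ((b \in a :: s) && (b != 0)); first by exists k.
  by exists 0 => bs b0; rewrite bs b0 in nb.
have [l /mapP nl] := exists_notin (map f (a :: s)) Kinf.
exists (x + l *: w) => b bs b0; apply/eqP => bxw.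
by apply: nl; exists b => //; apply: (fP b bs b0); rewrite -actZr -actDr.
Qed.

End Modules.

Local Notation upd x i u := (@dfwith {classic _} _ x i u).

(** * Replacing one entry, and equality up to finitely many entries *)

Section Families.
Variables (I : Type).

Lemma updii (T : I -> Type) (x : forall i, T i) i (u : T i) : upd x i u i = u.
Proof. exact: (@dfwith_in {classic I}). Qed.

Lemma upd_out (T : I -> Type) (x : forall i, T i) i (u : T i) j :
  j <> i -> upd x i u j = x j.
Proof. by move=> ji; apply: (@dfwith_out {classic I}); apply/eqP => /esym. Qed.

Lemma updP (T : I -> Type) (x y : forall i, T i) i (u : T i) :
  y i = u -> (forall j, j <> i -> y j = x j) -> y = upd x i u.
Proof.
move=> yi yj; apply: functional_extensionality_dep => j.
have [ji|ji] := pselect (j = i); last by rewrite upd_out // yj.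
by rewrite ji updii.
Qed.

Lemma upd_same (T : I -> Type) (x : forall i, T i) i : upd x i (x i) = x.
Proof. exact/esym/updP. Qed.

Lemma upd_upd (T : I -> Type) (x : forall i, T i) i (u v : T i) :
  upd (upd x i u) i v = upd x i v.
Proof. by apply: updP; rewrite ?updii // => j ji; rewrite !upd_out. Qed.

Lemma updC (T : I -> Type) (x : forall i, T i) i j (u : T i) (v : T j) :
  i <> j -> upd (upd x i u) j v = upd (upd x j v) i u.
Proof.
move=> ij; apply: updP; first by rewrite upd_out // updii.
move=> k ki; have [kj|kj] := pselect (k = j); last by rewrite !upd_out.
by rewrite kj !updii.
Qed.

Definition almost_eq (T : I -> Type) (x y : forall i, T i) :=
  finite_set [set i | x i <> y i].

Lemma almost_eq_refl (T : I -> Type) (x : forall i, T i) : almost_eq x x.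
Proof. by apply: (sub_finite_set _ (@finite_set0 I)) => i /=; apply. Qed.

Lemma almost_eq_sym (T : I -> Type) (x y : forall i, T i) :
  almost_eq x y -> almost_eq y x.
Proof. by apply: sub_finite_set => i /= + /esym. Qed.

Lemma almost_eq_trans (T : I -> Type) (y x z : forall i, T i) :
  almost_eq x y -> almost_eq y z -> almost_eq x z.
Proof.
move=> xy yz.
have yzU : finite_set ([set i | x i <> y i] `|` [set i | y i <> z i]).
  by rewrite finite_setU.
apply: sub_finite_set yzU => i /= xz.
by have [xyi|] := pselect (x i = y i); [right; rewrite -xyi|left].
Qed.

Lemma almost_eq_upd (T : I -> Type) (x : forall i, T i) i u :
  almost_eq (upd x i u) x.
Proof.
apply: sub_finite_set (finite_set1 i) => j /= ji.
by apply: contrapT => /(upd_out x u).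
Qed.

Lemma almost_eq_updl (T : I -> Type) (x y : forall i, T i) i u :
  almost_eq (upd x i u) y <-> almost_eq x y.
Proof.
have xu := almost_eq_upd x u; split; last exact: almost_eq_trans.
by apply: almost_eq_trans; apply: almost_eq_sym.
Qed.

Lemma almost_eq_map2 (S T U : I -> Type) (f : forall i, S i -> T i -> U i)
    (x x' : forall i, S i) (y y' : forall i, T i) :
  almost_eq x x' -> almost_eq y y' ->
  almost_eq (fun i => f i (x i) (y i)) (fun i => f i (x' i) (y' i)).
Proof.
move=> xx yy.
have U2 : finite_set ([set i | x i <> x' i] `|` [set i | y i <> y' i]).
  by rewrite finite_setU.
apply: sub_finite_set U2 => i /= ne.
have [xxi|] := pselect (x i = x' i); last by left.
by right => yyi; apply: ne; rewrite xxi yyi.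
Qed.

End Families.

(** * Spanning, projections, contractions and nonvanishing in tensor products *)

Section TensorProducts.
Variables (K : fieldType) (I : Type) (X : I -> lmodType K).
Variable T : tensor_product X.

Lemma tensor_upd_linear i x (k : K) (u v : X i) :
  tensor_map T (upd x i (k *: u + v)) =
  k *: tensor_map T (upd x i u) + tensor_map T (upd x i v).
Proof. exact: (tensor_multilinear T). Qed.

Lemma tensor_eq0 (x : forall i, X i) i : x i = 0 -> tensor_map T x = 0.
Proof.
move=> xi; have := tensor_upd_linear x (-1) (x i) (x i).
by rewrite scaleN1r addNr -{1}xi upd_same scaleN1r addNr.
Qed.

(** Holds in the model built from words, and is carried to an arbitrary [T] by the universal
    property. *)
Lemma tensor_span t : exists s : seq (K * (forall i, X i)),
  t = \sum_(p <- s) p.1 *: tensor_map T p.2.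
Proof.
pose C := canonical_tensor X.
pose g : {linear T -> C} := tensor_lift T (tensor_multilinear C).
pose h : {linear C -> T} := tensor_lift C (tensor_multilinear T).
have hg : h \o g =1 idfun.
  apply: tensor_ext => [||x]; [exact: linearP|by []|].
  by rewrite /= /g /h !tensor_liftE.
exists (tensor_word (g t)); rewrite -[LHS]hg /= {1}[g t]free_tensor_span.
rewrite linear_sum; apply: eq_bigr => p _.
by rewrite linearZ /=; congr (_ *: _); exact: (tensor_liftE C).
Qed.

(** Changing one entry never leaves a class, so cutting the tensor map down to a class keeps it
    multilinear. *)
Lemma tensor_class_projection (z : forall i, X i) :
  exists p : {linear T -> T}, forall x, p (tensor_map T x) =
    if `[< almost_eq x z >] then tensor_map T x else 0.
Proof.
pose f x := if `[< almost_eq x z >] then tensor_map T x else 0.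
have fM : multilinear f.
  move=> i x k u v; rewrite /f.
  have upd_class w : `[< almost_eq (upd x i w) z >] = `[< almost_eq x z >].
    by apply: asbool_equiv_eq; apply: almost_eq_updl.
  rewrite !upd_class; case: ifP => _; first exact: tensor_upd_linear.
  by rewrite scaler0 addr0.
by exists (tensor_lift T fM) => x; apply: tensor_liftE.
Qed.

(** The emptied slot is refilled with [v], so the result stays in [T] rather than in a product over
    the other indices. *)
Lemma tensor_contraction i (phi : X i -> K) (v : X i) :
  (forall k x y, phi (k *: x + y) = k * phi x + phi y) ->
  exists p : {linear T -> T}, forall x, p (tensor_map T x) =
    phi (x i) *: tensor_map T (upd x i v).
Proof.
move=> phiL; pose f x := phi (x i) *: tensor_map T (upd x i v).
have fM : multilinear f.
  move=> j x k u w; rewrite /f.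
  have [ij|ij] := pselect (j = i).
    move: u w; rewrite ij => u w.
    by rewrite !updii !upd_upd phiL scalerDl scalerA.
  rewrite !(updC _ _ _ ij) tensor_upd_linear !upd_out; try exact/nesym.
  by rewrite scalerDr !scalerA mulrC.
by exists (tensor_lift T fM) => x; apply: tensor_liftE.
Qed.

(* The functional is [⊗ y'_i |-> \prod_i phi_i (y'_i)] on the class of [y],  *)
(* where [phi_i (y_i) = 1], and zero on the other classes.                   *)
Lemma tensor_neq0 (y : forall i, X i) : (forall i, y i != 0) ->
  tensor_map T y != 0.
Proof.
move=> y0.
have /all_tag[phi phiP] i : {f : X i -> K &
    (forall k x z, f (k *: x + z) = k * f x + f z) /\ f (y i) = 1}.
  by apply: cid; have [f] := exists_dual_form (y0 i); exists f.
pose supp x : set {classic I} := [set i | x i <> y i].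
pose g x := \big[*%R/1]_(i \in supp x) phi i (x i).
(* Outside the support every factor is [phi i (y i) = 1]. *)
have gE x (D : set {classic I}) : finite_set D -> supp x `<=` D ->
    g x = \big[*%R/1]_(i \in D) phi i (x i).
  move=> Dfin xD; apply: fsbig_widen => // i /= [_ /contrapT ->].
  by have [_] := phiP i.
pose f (x : forall i, X i) : K^o := if `[< almost_eq x y >] then g x else 0.
have fM : multilinear f.
  move=> i x k u v; rewrite /f.
  have upd_class w : `[< almost_eq (upd x i w) y >] = `[< almost_eq x y >].
    by apply: asbool_equiv_eq; apply: almost_eq_updl.
  rewrite !upd_class; case: asboolP => [xy|_]; last by rewrite scaler0 addr0.
  (* One index set that serves every value put into slot [i]. *)
  pose D : set {classic I} := supp x `|` [set i].
  have Dfin : finite_set D.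
    by rewrite finite_setU; split=> //; exact: finite_set1.
  have gw w : g (upd x i w) =
      phi i w * \big[*%R/1]_(j \in D `\ i) phi j (x j).
    rewrite (gE _ D) //; last first.
      move=> j; rewrite /supp /D /=.
      have [->|ji] := pselect (j = i); first by right.
      by rewrite upd_out //; left.
    rewrite (fsbigD1 (i : {classic I})) //; last by right.
    rewrite updii; congr (_ * _); apply: eq_fsbigr => j.
    by rewrite inE => -[_ /= ji]; rewrite upd_out.
  rewrite !gw; have [-> _] := phiP i.
  by rewrite mulrDl -mulrA.
have: tensor_lift T fM (tensor_map T y) = 1.
  rewrite tensor_liftE /f asboolT; last exact: almost_eq_refl.
  by rewrite /g fsbig1 // => i /=.
move=> fy; apply/eqP => Ty0; move: fy; rewrite Ty0 linear0 => /esym/eqP.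
by rewrite oner_eq0.
Qed.

End TensorProducts.

(** * Annihilating tensors vanish *)

Section Faithfulness.
Variables (K : fieldType) (I : Type) (A : I -> assocAlgType K).
Variables (X : forall i, amodule (A i)).
Variable TA : tensor_product (fun i => A i : lmodType K).
Variable TX : tensor_product (fun i => amodule_space (X i)).
Hypothesis Xfaithful : forall i, faithful (X i).

(** With terms indexed by a subset, dropping some of them changes only [J]. *)
Definition tensor_word_sum (N : finType) (J : {set N}) (c : N -> K)
    (a : N -> forall i, A i) : TA :=
  \sum_(j in J) c j *: tensor_map TA (a j).

Definition act_family (a : forall i, A i) (x : forall i, X i) :
  forall i, X i := fun i => act (a i) (x i).

(** The whole class of [x] is tested because the argument puts vectors of its own choice into
    finitely many slots. *)
Definition kills (t : TA) (x : forall i, X i) :=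
  forall x', almost_eq x' x -> tensor_act t (tensor_map TX x') = 0.

(** Finitely many coincidences are allowed, so that the condition survives changing finitely many
    entries of [a] and [b]. *)
Definition separates (x : forall i, X i) (a b : forall i, A i) :=
  finite_set [set i | a i <> b i /\ act (a i) (x i) = act (b i) (x i)].

Lemma tensor_act_word_sum (N : finType) (J : {set N}) c a x :
  tensor_act (tensor_word_sum J c a) (tensor_map TX x) =
  \sum_(j in J) c j *: tensor_map TX (act_family (a j) x).
Proof.
rewrite (big_morph (fun t : TA => tensor_act t (tensor_map TX x))
  (id1 := 0) (op1 := +%R)).
- by apply: eq_bigr => j _; rewrite tensor_actZl tensor_actE.
- by move=> t u; rewrite tensor_actDl.
- exact: (act0l (M := tensor_module TA TX)).
Qed.

Lemma killsB t u x : kills t x -> kills u x -> kills (t - u) x.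
Proof.
move=> tx ux x' xx; have := actBl (M := tensor_module TA TX) t u.
by move=> /(_ (tensor_map TX x')) /= ->; rewrite tx // ux // subrr.
Qed.

Lemma separates_almost_eq x a a' b b' : almost_eq a a' -> almost_eq b b' ->
  separates x a b -> separates x a' b'.
Proof.
move=> aa bb ab; have U3 : finite_set ([set i | a i <> a' i] `|`
    [set i | b i <> b' i] `|`
    [set i | a i <> b i /\ act (a i) (x i) = act (b i) (x i)]).
  by rewrite !finite_setU.
apply: sub_finite_set U3 => i /= abi.
have [aai|] := pselect (a i = a' i); last by left; left.
have [bbi|] := pselect (b i = b' i); last by left; right.
by right; rewrite aai bbi.
Qed.

Lemma almost_eq_act_family a b x y : almost_eq a b -> almost_eq x y ->
  almost_eq (act_family a x) (act_family b y).
Proof. exact: (almost_eq_map2 (fun i (u : A i) (v : X i) => act u v)). Qed.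

Lemma separates_act_family x a b : separates x a b ->
  almost_eq (act_family a x) (act_family b x) -> almost_eq a b.
Proof.
move=> xab xx; have U2 : finite_set
    ([set i | a i <> b i /\ act (a i) (x i) = act (b i) (x i)] `|`
     [set i | act_family a x i <> act_family b x i]).
  by rewrite finite_setU.
apply: sub_finite_set U2 => i /= abi.
by have [e|] := pselect (act_family a x i = act_family b x i); [left|right].
Qed.

(** Project the relation onto the class of [act_family (a j0) x]: by separation, the surviving terms
    are those with [a j] in the class of [a j0]. *)
Lemma kills_class (N : finType) (J : {set N}) c a x j0 :
  (forall j k, separates x (a j) (a k)) ->
  kills (tensor_word_sum J c a) x ->
  kills (tensor_word_sum [set j in J | `[< almost_eq (a j) (a j0) >]] c a) x.
Proof.
move=> gen tx x' xx.
have [p pE] := tensor_class_projection TX (act_family (a j0) x).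
have /(congr1 p) := tx _ xx.
rewrite !tensor_act_word_sum linear0 linear_sum => pt.
rewrite -[RHS]pt big_mkcond [RHS]big_mkcond; apply: eq_bigr => j _.
rewrite inE; case: (j \in J) => //=.
rewrite linearZ /= pE.
have -> : `[< almost_eq (act_family (a j) x') (act_family (a j0) x) >] =
    `[< almost_eq (a j) (a j0) >].
  apply: asbool_equiv_eq; split=> [jj0|jj0].
    apply: (separates_act_family (gen _ _)); apply: almost_eq_trans jj0.
    apply: almost_eq_act_family; first exact: almost_eq_refl.
    exact: almost_eq_sym.
  exact: almost_eq_act_family.
by case: ifP; rewrite ?scaler0.
Qed.

(** With [n := #|J|] this is the induction hypothesis for words shorter than [J]; it ranges over all
    families since equalizing a slot alters them. *)
Definition word_eq0 n := forall (N : finType) (J : {set N}) c a x,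
  (#|J| < n)%N -> (forall j k, separates x (a j) (a k)) ->
  (forall j, separates x (a j) (fun=> 0)) ->
  kills (tensor_word_sum J c a) x -> tensor_word_sum J c a = 0.

(* Contracting the slot [i] against a form [phi] with [phi (e w) = 1], where *)
(* [e := a j0 i], yields a word [u] that kills as well and has all [i]-th     *)
(* entries equal to [e]; in [t - u] the term [j0] disappears.                *)
Lemma equalize_slot (N : finType) (J : {set N}) c a x j0 i :
  word_eq0 #|J| -> j0 \in J -> a j0 i != 0 ->
  (forall j k, separates x (a j) (a k)) ->
  (forall j, separates x (a j) (fun=> 0)) ->
  kills (tensor_word_sum J c a) x ->
  exists c', tensor_word_sum J c a =
    tensor_word_sum J c' (fun j => upd (a j) i (a j0 i)).
Proof.
move=> IH j0J e0 gen gen0 tx; set e := a j0 i.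
have [w ew] := faithful_act_neq0 (Xfaithful (i := i)) e0.
have [phi phiL phi1] := exists_dual_form ew.
pose p j := phi (act (a j i) w).
exists (fun j => c j * p j); set u := RHS; apply/eqP; rewrite -subr_eq0.
(* Act with [w] in slot [i], contract against [phi] and refill with [act e (x' i)]: each term
   becomes [p j] times the action of a family with entry [e] at [i]. *)
have ux : kills u x.
  move=> x' xx; have [q qE] := tensor_contraction TX (act e (x' i)) phiL.
  have /tx/(congr1 q) : almost_eq (upd x' i w) x by apply/almost_eq_updl.
  rewrite !tensor_act_word_sum linear0 linear_sum => qt; rewrite -[RHS]qt.
  apply: eq_bigr => j _; rewrite linearZ /= qE /act_family updii scalerA.
  congr (_ *: tensor_map TX _); apply: functional_extensionality_dep => k.
  have [->|ki] := pselect (k = i); first by rewrite !updii.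
  by rewrite !upd_out.
have tuE : tensor_word_sum J c a - u =
    tensor_word_sum (J :\ j0) c (fun j => upd (a j) i (a j i - p j *: e)).
  rewrite /u /tensor_word_sum -sumrB [LHS]big_mkcond [RHS]big_mkcond.
  apply: eq_bigr => j _; rewrite !inE.
  case: (j \in J); rewrite ?andbF ?andbT //.
  have -> : a j i - p j *: e = (- p j) *: e + a j i by rewrite scaleNr addrC.
  rewrite (tensor_upd_linear TA) upd_same.
  case: eqP => [->|_] /=.
    by rewrite /p /e phi1 mulr1 upd_same subrr.
  by rewrite scalerDr scalerA mulrN scaleNr addrC.
rewrite tuE; apply/eqP/IH.
- by rewrite (cardsD1 j0 J) j0J.
- by move=> j k; apply: separates_almost_eq (gen j k);
     apply: almost_eq_sym; apply: almost_eq_upd.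
- move=> j; apply: separates_almost_eq (gen0 j); last exact: almost_eq_refl.
  by apply: almost_eq_sym; apply: almost_eq_upd.
- by rewrite -tuE; apply: killsB.
Qed.

(** Equalizing keeps [J] and the family [a j0], so the same induction hypothesis serves every slot
    of [F]. *)
Lemma equalize_slots (N : finType) (J : {set N}) c a x j0
    (F : seq {classic I}) :
  word_eq0 #|J| -> j0 \in J -> (forall i, a j0 i != 0) ->
  (forall j k, separates x (a j) (a k)) ->
  (forall j, separates x (a j) (fun=> 0)) ->
  kills (tensor_word_sum J c a) x ->
  exists c', tensor_word_sum J c a =
    tensor_word_sum J c'
      (fun j i => if (i : {classic I}) \in F then a j0 i else a j i).
Proof.
move=> IH j0J a0 gen gen0 tx; elim: F => [|i F [c' tE]]; first by exists c.
set a' := fun j : N => _ in tE.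
have aa' j : almost_eq (a j) (a' j).
  apply: sub_finite_set (finite_seq F) => k /=; rewrite /a'.
  by case: ifP.
have a'j0 k : a' j0 k = a j0 k by rewrite /a'; case: ifP.
have [||||c'' tE'] := @equalize_slot N J c' a' x j0 i IH j0J.
- by rewrite a'j0.
- by move=> j k; apply: separates_almost_eq (gen j k).
- by move=> j; apply: separates_almost_eq (gen0 j); last exact: almost_eq_refl.
- by rewrite -tE.
exists c''; rewrite tE tE' /tensor_word_sum; apply: eq_bigr => j _.
congr (_ *: tensor_map TA _); apply/esym/updP => [|k ki].
  by rewrite inE eqxx a'j0.
by rewrite inE (negbTE (introN eqP _)).
Qed.

Lemma word_eq0_all n : word_eq0 n.
Proof.
elim: n => // n IHn N J c a x Jn gen gen0 tx.
have IH : word_eq0 #|J|.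
  by move=> N' J' c' a' x' J'J; apply: IHn; exact: leq_trans J'J Jn.
have [J0|[j0 j0J]] := set_0Vmem J.
  by rewrite /tensor_word_sum J0 big_set0.
have [[i ai]|/forallNP a0] := pselect (exists i, a j0 i = 0).
  have tE : tensor_word_sum J c a = tensor_word_sum (J :\ j0) c a.
    rewrite /tensor_word_sum (big_setD1 j0) //= (tensor_eq0 TA ai).
    by rewrite scaler0 add0r.
  rewrite tE; apply: (IH _ _ _ _ x) => //; last by rewrite -tE.
  by rewrite [ltnRHS](cardsD1 j0) j0J.
have {}a0 i : a j0 i != 0 by exact/eqP/a0.
(* With at least two classes, the class of [j0] and its complement are both shorter words that
   kill. *)
have [[k [kJ kj0]]|/forallNP sameclass] :=
    pselect (exists k, k \in J /\ ~ almost_eq (a k) (a j0)).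
  pose J1 := [set j in J | `[< almost_eq (a j) (a j0) >]]%SET.
  have tE : tensor_word_sum J c a =
      tensor_word_sum J1 c a + tensor_word_sum (J :\: J1)%SET c a.
    rewrite /tensor_word_sum (big_setID J1) /=; congr (_ + _).
    by apply: eq_bigl => j; rewrite !inE; case: (j \in J).
  have t1x : kills (tensor_word_sum J1 c a) x by apply: kills_class.
  have J1J : (#|J1| < #|J|)%N.
    apply: proper_card; apply/properP; split.
      by apply/fintype.subsetP => j; rewrite inE => /andP[].
    by exists k; rewrite // inE kJ; apply/asboolPn.
  have J2J : (#|J :\: J1| < #|J|)%N.
    apply: proper_card; apply/properP; split; first exact: finset.subsetDl.
    by exists j0; rewrite // !inE j0J asboolT //; apply: almost_eq_refl.
  rewrite tE (IH _ _ _ _ x J1J) // add0r; apply: (IH _ _ _ _ x J2J) => //.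
  by have := killsB tx t1x; rewrite tE addrC addKr.
have Jj0 j : j \in J -> almost_eq (a j) (a j0).
  by move=> jJ; apply: contrapT => jj0; apply: (sameclass j).
have [F FP] : exists F : seq {classic I}, forall j (i : {classic I}), j \in J ->
    i \notin F -> a j i = a j0 i.
  have : finite_set
      (\bigcup_(j in [set` J]) [set i : {classic I} | a j i <> a j0 i]).
    by apply: bigcup_finite => // j /=; apply: Jj0.
  move=> /finite_seqP[F FE]; exists F => j i jJ iF.
  apply: contrapT => aij; move/negP: iF; apply.
  have : [set` F] i by rewrite -FE; exists j.
  by [].
have [c' tE] := equalize_slots F IH j0J a0 gen gen0 tx.
have {}tE : tensor_word_sum J c a =
    (\sum_(j in J) c' j) *: tensor_map TA (a j0).
  rewrite tE scaler_suml; apply: eq_bigr => j jJ; congr (_ *: tensor_map TA _).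
  apply: functional_extensionality_dep => i.
  by case: ifPn => // /FP ->.
have /all_tag[w aw] i : {w : X i & act (a j0 i) w != 0}.
  exact: cid (faithful_act_neq0 _ _).
(* Repairs the slots where [a j0 i] annihilates [x i]; by [gen0] there are finitely many. *)
pose x' i := if `[< act (a j0 i) (x i) = 0 >] then w i else x i.
have x'x : almost_eq x' x.
  apply: sub_finite_set (gen0 j0) => i /=; rewrite /x' act0l.
  by case: asboolP => // axi _; split=> //; apply/eqP.
have /eqP := tx _ x'x; rewrite tE tensor_actZl tensor_actE scaler_eq0.
case/orP => [/eqP ->|]; first by rewrite scale0r.
apply/contraTeq => _; apply: tensor_neq0 => i; rewrite /x'.
by case: asboolP => [_|/eqP].
Qed.

Lemma tensor_module_faithful : infinite_set [set: K] ->
  faithful (tensor_module TA TX).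
Proof.
move=> Kinf t u tu; apply/eqP; rewrite -subr_eq0.
have {}tu y : tensor_act (t - u) y = 0 :> TX.
  apply: etrans (actBl (M := tensor_module TA TX) t u y) _.
  by apply/eqP; rewrite subr_eq0; apply/eqP; exact: (congr1 (@^~ y) tu).
have [s tuE] := tensor_span (t - u).
pose c (j : 'I_(size s)) := (tnth (in_tuple s) j).1.
pose a (j : 'I_(size s)) := (tnth (in_tuple s) j).2.
have {}tuE : t - u = tensor_word_sum [set: 'I_(size s)] c a.
  by rewrite tuE /tensor_word_sum big_tnth; apply: eq_bigl => j; rewrite inE.
(* Avoiding the kernels of all nonzero entries and differences of entries makes the exceptional sets
   in [separates] empty. *)
have /all_tag[x xP] i : {x : X i & forall d : A i,
    d \in [seq a j i | j : 'I_(size s)] ++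
          [seq a jk.1 i - a jk.2 i | jk : 'I_(size s) * 'I_(size s)] ->
    d != 0 -> act d x != 0}.
  exact: cid (exists_generic_vector _ Kinf (Xfaithful (i := i))).
rewrite tuE; apply/eqP/(word_eq0_all (ltnSn _) (x := x)).
- move=> j k; apply: sub_finite_set (@finite_set0 I) => i /= [/eqP].
  rewrite -subr_eq0 => ajk /eqP.
  rewrite -subr_eq0 -actBl; apply/negP/xP => //; rewrite mem_cat.
  by apply/orP; right; apply/mapP; exists (j, k); rewrite ?mem_enum.
- move=> j; apply: sub_finite_set (@finite_set0 I) => i /= [/eqP aj].
  rewrite act0l => /eqP; apply/negP/xP => //; rewrite mem_cat.
  by apply/orP; left; apply/mapP; exists j; rewrite ?mem_enum.
- by move=> x' _; rewrite -tuE.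
Qed.

End Faithfulness.

(** * Complex scalars and the unital case *)

Lemma infinite_setT_injective (T U : Type) (f : T -> U) : injective f ->
  infinite_set [set: T] -> infinite_set [set: U].
Proof.
move=> finj Tinf Ufin; apply: Tinf.
apply: (@finite_preimage _ _ setT f); last exact: Ufin.
by move=> x y _ _ /finj.
Qed.

Lemma infinite_complex (R : realType) : infinite_set [set: complex R].
Proof.
apply: (infinite_setT_injective (f := fun n : nat => n%:R)) infinite_nat.
by move=> m n /eqP; rewrite eqr_nat => /eqP.
Qed.

Lemma scalar_module_faithful (K : fieldType) (Y : lmodType K) :
  nonzero_space Y -> faithful (scalar_module Y).
Proof.
move=> [y y0] a b /(congr1 (@^~ y)) /= /eqP.
by rewrite -subr_eq0 -scalerBl scaler_eq0 (negbTE y0) orbF subr_eq0 => /eqP.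
Qed.

(** The unit is the tensor of the constant family [1]; by [tensor_ext] each identity is checked on
    elementary tensors. *)
Lemma tensor_scalar_module_unital (K : fieldType) (I : Type)
    (Y : I -> lmodType K) (TC : tensor_product (fun=> K^o : lmodType K))
    (TY : tensor_product Y) :
  unital_module (@tensor_module K I (fun=> K^o) TC
    (fun i => scalar_module (Y i)) TY).
Proof.
pose e := tensor_map TC (fun=> 1); exists e; split=> [t|y].
  split.
    apply: (@tensor_ext K I _ TC TC (tensor_mul e) id) => [k u v|//|a].
      by rewrite tensor_mulDr tensor_mulZr.
    rewrite tensor_mulE; congr tensor_map.
    by apply: functional_extensionality_dep => i; exact: mul1r.
  pose r : TC -> TC := (@tensor_mul K I (fun=> K^o) TC)^~ e.
  apply: (@tensor_ext K I _ TC TC r id) => [k u v|//|a]; rewrite /r.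
    by rewrite tensor_mulDl tensor_mulZl.
  rewrite tensor_mulE; congr tensor_map.
  by apply: functional_extensionality_dep => i; exact: mulr1.
pose f : TY -> TY := @tensor_act K I (fun=> K^o) TC
  (fun i => scalar_module (Y i)) TY e.
apply: (@tensor_ext K I Y TY TY f id) => [k u v|//|x]; rewrite /f.
  by rewrite tensor_actDr tensor_actZr.
rewrite tensor_actE; congr tensor_map.
by apply: functional_extensionality_dep => i; exact: scale1r.
Qed.

Theorem corollary2p9 (R : realType) (I : Type)
    (I_infinite : infinite_set [set: I]%classic) :
  (forall (A : I -> assocAlgType (complex R)) (X : forall i : I, amodule (A i))
      (TA : tensor_product (fun i : I => A i : lmodType (complex R)))
      (TX : tensor_product (fun i : I => amodule_space (X i))),
    (forall i : I, nonzero_space (X i)) ->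
    (forall i : I, faithful (X i)) ->
    faithful (tensor_module TA TX))
  /\
  (forall (Y : I -> lmodType (complex R))
      (TC : tensor_product
              (fun i : I => (complex R)^o%R : lmodType (complex R)))
      (TY : tensor_product Y),
    (forall i : I, nonzero_space (Y i)) ->
    let M := @tensor_module (complex R) I (fun i : I => (complex R)^o%R) TC
               (fun i : I => scalar_module (Y i)) TY in
    faithful M /\ unital_module M).
Proof.
have Cinf := @infinite_complex R; split=> [A X TA TX _ Xf|Y TC TY Y0 M].
  exact: tensor_module_faithful.
split; last exact: tensor_scalar_module_unital.
by apply: tensor_module_faithful => // i; apply: scalar_module_faithful.
Qed.
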